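(* Let $D=(V,E)$ be a weakly connected finite directed graph, let $\mathcal{T}$ be any dissecting tree set of $D$, and fix a total ordering of the edges of $D$. Then for every $i\ge 0$, the coefficient of $t^i$ in $h^*_D$ equals the number of trees $T\in\mathcal{T}$ that have exactly $i$ internally semi-passive edges (with respect to the fixed ordering).
   Context: For an edge $e$ with tail $t$ and head $h$, let $\mathbf{x}_e\in\mathbb{R}^V$ have coordinate $1$ at $h$, $-1$ at $t$, $0$ elsewhere. For a set $F$ of edges let $\tilde{\mathcal{Q}}_F=\operatorname{conv}(\{\mathbf{0}\}\cup\{\mathbf{x}_e\mid e\in F\})$; $\tilde{\mathcal{Q}}_D=\tilde{\mathcal{Q}}_E$ is the extended root polytope. The $h^*$-polynomial of a $d$-dimensional lattice polytope $Q\subset\mathbb{R}^n$ is $\sum_{i=0}^d h^*_i t^i=(1-t)^{d+1}\sum_{k\ge 0}|(kQ)\cap\mathbb{Z}^n|\,t^k$, and $h^*_D$ is that of $\tilde{\mathcal{Q}}_D$ (lattice $\mathbb{Z}^V$). A spanning tree of $D$ is a set of edges forming a spanning tree of the underlying undirected graph (orientations ignored). A set $\mathcal{T}$ of spanning trees is a dissecting tree set if the simplices $\tilde{\mathcal{Q}}_T$, $T\in\mathcal{T}$, are pairwise interior-disjoint and their union is $\tilde{\mathcal{Q}}_D$. For a spanning tree $T$ and $e\in T$, the fundamental cut $C^*(T,e)$ is the set of edges of $D$ joining the two components of $T-e$ (whose vertex sets are the shores). An edge $e'\in C^*(T,e)$ stands parallel to $e$ if the heads of $e$ and $e'$ lie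 in the same shore, and opposite otherwise. An edge $e\in T$ is internally semi-active for $T$ if the minimal edge (in the fixed ordering) of $C^*(T,e)$ stands parallel to $e$, and internally semi-passive otherwise. *)

(* Defs.v *)
From HB Require Import structures.
From mathcomp Require Import all_boot all_order all_algebra finmap.
From mathcomp Require Import boolp classical_sets cardinality reals.

Set Implicit Arguments.
Unset Strict Implicit.
Unset Printing Implicit Defensive.

Import Order.TTheory GRing.Theory Num.Theory.

Local Open Scope classical_set_scope.
Local Open Scope ring_scope.

(* Polytopes in R^V, points being finite functions V -> R. *)

Section Polytopes.
Variables (R : realType) (V : finType).
Implicit Types (A Q : set {ffun V -> R}) (x y : {ffun V -> R}).

Definition conv_hull A : set {ffun V -> R} :=
  [set x : {ffun V -> R} | exists n (p : 'I_n -> {ffun V -> R}) (w : 'I_n -> R),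
    [/\ forall i, A (p i), forall i, 0 <= w i, \sum_i w i = 1 &
        forall v, x v = \sum_i w i * p i v]].

Definition aff_hull A : set {ffun V -> R} :=
  [set x : {ffun V -> R} | exists n (p : 'I_n -> {ffun V -> R}) (w : 'I_n -> R),
    [/\ forall i, A (p i), \sum_i w i = 1 &
        forall v, x v = \sum_i w i * p i v]].

(* The Euclidean topology is described by the balls of the sup norm. *)
Definition rel_interior A : set {ffun V -> R} :=
  [set x : {ffun V -> R} | A x /\ exists2 eps : R, 0 < eps &
    forall y, aff_hull A y -> (forall v, `|y v - x v| < eps) -> A y].

Definition aff_indep n (p : 'I_n -> {ffun V -> R}) : Prop :=
  forall c : 'I_n -> R, \sum_i c i = 0 ->
    (forall v, \sum_i c i * p i v = 0) -> forall i, c i = 0.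

Definition has_dim A (d : nat) : Prop :=
  (exists2 p : 'I_d.+1 -> {ffun V -> R}, forall i, A (p i) & aff_indep p) /\
  (forall p : 'I_d.+2 -> {ffun V -> R}, (forall i, A (p i)) -> ~ aff_indep p).

Definition dilate (k : nat) A : set {ffun V -> R} :=
  [set [ffun v => k%:R * x v] | x in A].

Definition lattice_points A : set {ffun V -> int} :=
  [set m : {ffun V -> int} | A [ffun v => (m v)%:~R]].

(* [fset_set] is meaningful on finite sets only; the lattice points of a
   bounded set are finite in number. *)
Definition ehrhart Q (k : nat) : nat :=
  #|` fset_set (lattice_points (dilate k Q))|.

(* h has degree at most d = dim Q, and is equal to the formal power series
   (1 - t)^(d+1) * \sum_k (ehrhart Q k) t^k, whose i-th coefficient is written
   as a Cauchy product. *)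
Definition is_hstar Q (h : {poly int}) : Prop :=
  exists2 d, has_dim Q d & (size h <= d.+1)%N /\
    forall i, h`_i =
      \sum_(j < i.+1) ((1 - 'X) ^+ d.+1 : {poly int})`_j
                      * (ehrhart Q (i - j))%:Z.

(* The default 0 is never the h*-polynomial of a nonempty lattice polytope, whose constant
   coefficient is 1. *)
Definition hstar_poly Q : {poly int} := xget 0 [set h | is_hstar Q h].

End Polytopes.

(* Multiple edges and loops are allowed. *)
Record digraph (V E : finType) := Digraph { tail : E -> V; head : E -> V }.

Section Digraphs.
Variables (V E : finType) (D : digraph V E).
Implicit Types (F T : {set E}) (e : E) (u v : V) (TT : {set {set E}}).

Definition adjacent F u v : bool :=
  [exists e in F, ((tail D e == u) && (head D e == v))
               || ((tail D e == v) && (head D e == u))].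

Definition connected_by F : Prop := forall u v, connect (adjacent F) u v.

Definition weakly_connected : Prop := (0 < #|V|)%N /\ connected_by [set: E]%SET.

(* A dart (e, b) is the edge e traversed from tail to head if b = true, and from
   head to tail if b = false. *)
Definition dart_src (a : E * bool) : V := if a.2 then tail D a.1 else head D a.1.
Definition dart_tgt (a : E * bool) : V := if a.2 then head D a.1 else tail D a.1.

Definition graph_cycle F (c : seq (E * bool)) : bool :=
  [&& c != [::], all (fun a => a.1 \in F) c,
      path.cycle (fun a b => dart_tgt a == dart_src b) c,
      uniq [seq dart_src a | a <- c] & uniq [seq a.1 | a <- c]].

Definition spanning_tree T : Prop :=
  connected_by T /\ forall c, ~~ graph_cycle T c.

(* u and v lie in the same component of T - e. *)
Definition same_shore T e : rel V := connect (adjacent (T :\ e)).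

Definition fund_cut T e : {set E} :=
  [set f | ~~ same_shore T e (tail D f) (head D f)]%SET.

Definition stands_parallel T e f : bool := same_shore T e (head D e) (head D f).

Definition semi_active (le : rel E) T e : bool :=
  [exists f in fund_cut T e,
    [forall g in fund_cut T e, le f g] && stands_parallel T e f].

Definition semi_passive_edges (le : rel E) T : {set E} :=
  [set e in T | ~~ semi_active le T e]%SET.

Variable R : realType.

Definition edge_vector e : {ffun V -> R} :=
  [ffun v => (v == head D e)%:R - (v == tail D e)%:R].

Definition root_polytope_of F : set {ffun V -> R} :=
  conv_hull ([set [ffun=> 0]] `|` [set edge_vector e | e in [set` F]]).

Definition ext_root_polytope : set {ffun V -> R} := root_polytope_of [set: E]%SET.

Definition dissecting_tree_set TT : Prop :=
  [/\ forall T, T \in TT -> spanning_tree T,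
      forall T1 T2, T1 \in TT -> T2 \in TT -> T1 != T2 ->
        rel_interior (root_polytope_of T1)
          `&` rel_interior (root_polytope_of T2) = set0 &
      \bigcup_(T in [set` TT]) root_polytope_of T = ext_root_polytope].

End Digraphs.

Arguments edge_vector {V E} D R e.
Arguments root_polytope_of {V E} D R F _.
Arguments ext_root_polytope {V E} D R _.
Arguments dissecting_tree_set {V E} D R TT.

(* Main.v *)
From mathcomp Require Import all_boot all_order all_algebra finmap.
From mathcomp Require Import boolp classical_sets cardinality reals.
From mathcomp Require Import ring lra.
Require Import Defs.

Set Implicit Arguments.
Unset Strict Implicit.
Unset Printing Implicit Defensive.

Import Order.TTheory GRing.Theory Num.Theory.

Local Open Scope ring_scope.

(* The edge vectors of a spanning tree T are a lattice basis of the hyperplane of points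
   with coordinate sum 0; the coordinate of x on e in T is the sum of x over the shore of
   T - e containing the head of e.  Let q be the sum of w_f x_f over all edges f, with small
   positive weights w_f that decrease very fast along the ordering.  Its coordinate on e
   is a signed sum of the weights of the edges of the fundamental cut, in which the minimal
   edge dominates: it is positive if e is semi-active and negative if e is semi-passive.
   Hence the facets of the simplex of T visible from q are exactly those opposite to
   the semi-passive edges.  Removing these facets from every simplex of the dissection gives
   half-open simplices that partition the root polytope: push a point slightly towards q.
   A half-open unimodular simplex of dimension d with i facets removed has
   C(k - i + d, d) lattice points in its k-th dilate, hence contributes t^i to h*. *)

(** * Power series of binomial coefficients and counting of bounded tuples *)

Section Cauchy.

Lemma coefM_congr (p q r : {poly int}) n :
  (forall k, (k <= n)%N -> q`_k = r`_k) -> (p * q)`_n = (p * r)`_n.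
Proof.
move=> eq_qr; rewrite !coefM; apply: eq_bigr => j _.
by rewrite eq_qr // leq_subr.
Qed.

(** The coefficient of t^k in t^s / (1 - t)^(d+1). The test is essential: for k < s the truncated
    subtraction would yield 1. *)
Definition shifted_bin (s d k : nat) : nat :=
  if (s <= k)%N then 'C(k - s + d, d) else 0.

Lemma coef_1subXM (q : {poly int}) k :
  ((1 - 'X) * q)`_k = q`_k - (if k is k'.+1 then q`_k' else 0).
Proof. by rewrite mulrBl mul1r coefB coefXM; case: k. Qed.

(** Pascal's rule: multiplying the series by 1 - t lowers its pole order by one. *)
Lemma shifted_binS s d k :
  (shifted_bin s d.+1 k.+1)%:Z - (shifted_bin s d.+1 k)%:Z
  = (shifted_bin s d k.+1)%:Z.
Proof.
rewrite /shifted_bin; case: (leqP s k) => [le_sk|].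
  by rewrite leqW // subSn // addSn binS PoszD addrC addnS addSn addKr.
rewrite subr0 => lt_ks; case: (leqP s k.+1) => // le_sk.
have -> : s = k.+1 by apply/eqP; rewrite eqn_leq le_sk.
by rewrite subnn !binn.
Qed.

(** Each factor 1 - t lowers d by one. The series is truncated at [N] to be a polynomial, which
    coefficients below [N] do not see. *)
Lemma coef_1subX_exp_shifted_bin s d n N : (n < N)%N ->
  ((1 - 'X) ^+ d.+1 * \poly_(k < N) (shifted_bin s d k)%:Z)`_n
  = (n == s)%:Z.
Proof.
elim: d n => [|d IHd] n lt_nN.
  rewrite expr1 coef_1subXM coef_poly lt_nN /shifted_bin !bin0.
  case: n lt_nN => [|n] lt_nN; first by rewrite subr0; case: s.
  rewrite coef_poly (ltnW lt_nN) bin0; case: (ltngtP s n.+1) => [||->].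
  - by rewrite ltnS => ->.
  - by move=> lt_ns; rewrite leqNgt (ltnW lt_ns).
  - by rewrite ltnn.
rewrite exprSr -mulrA -(IHd n lt_nN); apply: coefM_congr => k le_kn.
have lt_kN := leq_ltn_trans le_kn lt_nN.
rewrite coef_1subXM !coef_poly lt_kN.
case: k {le_kn} lt_kN => [|k] lt_kN.
  by rewrite subr0 /shifted_bin; case: s {IHd} => //; rewrite !binn.
by rewrite coef_poly (ltnW lt_kN) shifted_binS.
Qed.

Lemma cauchy_shifted_bin s d n :
  \sum_(j < n.+1) ((1 - 'X) ^+ d.+1 : {poly int})`_j
    * (shifted_bin s d (n - j))%:Z = (n == s)%:Z.
Proof.
rewrite -(coef_1subX_exp_shifted_bin s d (ltnSn n)) coefM.
by apply: eq_bigr => j _; rewrite coef_poly ltnS leq_subr.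
Qed.

(** An entry never exceeds the sum, so enlarging the range of the entries from m to k adds no tuple;
    the rest is the known count of partial ordered partitions. *)
Lemma card_tuple_sum_le d m k : (m <= k)%N ->
  #|[set t : d.-tuple 'I_k.+1 | \sum_(i <- t) i <= m]%N| = 'C(m + d, d).
Proof.
move=> le_mk; rewrite addnC -card_partial_ord_partitions.
have lt_mk : (m.+1 <= k.+1)%N by [].
pose wid (t : d.-tuple 'I_m.+1) := [tuple of map (widen_ord lt_mk) t].
have wid_inj : injective wid.
  move=> t u /(congr1 val) /= /inj_map eq_tu; apply/val_inj/eq_tu.
  by move=> x y /(congr1 val) /= /val_inj.
rewrite -(card_imset _ wid_inj); apply: eq_card => t; rewrite inE.
apply/idP/imsetP => [le_tm|[u]]; last by rewrite inE => ? ->; rewrite big_map.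
have lt_t x : x \in t -> (x < m.+1)%N.
  move=> xt; rewrite ltnS; apply: leq_trans le_tm.
  by rewrite (big_rem x) //= leq_addr.
have widK : [seq widen_ord lt_mk (inord (x : 'I_k.+1) : 'I_m.+1) | x <- t] = t.
  rewrite -[RHS]map_id; apply/eq_in_map => x /lt_t lt_xm.
  by apply: val_inj; rewrite /= inordK.
exists [tuple of [seq inord (x : 'I_k.+1) : 'I_m.+1 | x <- t]].
  rewrite inE big_map big_seq (eq_bigr (fun x : 'I_k.+1 => nat_of_ord x)).
    by rewrite -big_seq.
  by move=> x /lt_t lt_xm; rewrite inordK.
by apply: val_inj; rewrite /= -map_comp widK.
Qed.

Lemma map_nth_index (A : eqType) (B : Type) (b0 : B) (s : seq A) (t : seq B) :
  uniq s -> size t = size s -> [seq nth b0 t (index a s) | a <- s] = t.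
Proof.
move=> uniq_s eq_sz; apply: (@eq_from_nth _ b0); rewrite size_map // => i lt_i.
case: s uniq_s eq_sz lt_i => // a s uniq_s _ lt_i.
by rewrite (nth_map a) // index_uniq.
Qed.

End Cauchy.

(** * Shores and fundamental cuts of a spanning tree *)

Section Trees.
Variables (V E : finType) (D : digraph V E).
Implicit Types (T : {set E}) (e f : E) (u v : V).

Lemma adjacent_sym T : symmetric (adjacent D T).
Proof.
by move=> u v; apply: eq_existsb => e; rewrite orbC.
Qed.

Lemma same_shore_sym T e : symmetric (same_shore D T e).
Proof. exact: sym_connect_sym (adjacent_sym _). Qed.

Lemma same_shore_trans T e : transitive (same_shore D T e).
Proof. by move=> v u w; apply: connect_trans. Qed.

Lemma same_shoreP T e f : f \in T -> f != e ->
  same_shore D T e (tail D f) (head D f).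
Proof.
move=> fT fe; apply/connect1/existsP; exists f.
by rewrite !inE fe fT !eqxx.
Qed.

(** Turns a simple path of vertices into darts with distinct edges, the form required by
    [graph_cycle]. *)
Lemma uniq_path_darts T u p :
  path (adjacent D T) u p -> uniq (u :: p) ->
  exists c, [/\ all (fun a => a.1 \in T) c,
    [seq dart_src D a | a <- c] = belast u p,
    [seq dart_tgt D a | a <- c] = p & uniq [seq a.1 | a <- c]].
Proof.
elim: p u => [|w p IHp] u /=; first by exists [::].
case/andP=> /existsP[e /andP[eT e_uw]] path_p /andP[u_p uniq_p].
have [c [cT c_src c_tgt uniq_c]] := IHp w path_p uniq_p.
have [b [b_src b_tgt]] : exists b, dart_src D (e, b) = u /\ dart_tgt D (e, b) = w.
  by case/orP: e_uw => /andP[/eqP ? /eqP ?]; [exists true | exists false].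
exists ((e, b) :: c); split; rewrite /= ?eT ?b_src ?b_tgt ?c_src ?c_tgt //.
(* If [e] recurred in [c], both of its ends would be later vertices of the path; but [u] is one of
   its ends. *)
rewrite uniq_c andbT; apply/mapP => -[[f b'] fc /= e_f].
have src_p : dart_src D (f, b') \in w :: p.
  by apply: mem_belast; rewrite -c_src; apply: map_f.
have tgt_p : dart_tgt D (f, b') \in w :: p.
  by rewrite inE -c_tgt (map_f _ fc) orbT.
move: u_p; rewrite -b_src e_f; move: src_p tgt_p.
by rewrite /dart_src /dart_tgt /=; case: b {b_src b_tgt}; case: b' {fc} => in_p1 in_p2;
  rewrite ?in_p1 ?in_p2.
Qed.

Lemma dart_path a c :
  [seq dart_src D b | b <- c] = belast (dart_tgt D a) [seq dart_tgt D b | b <- c] ->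
  path (fun a b => dart_tgt D a == dart_src D b) a c.
Proof.
elim: c a => //= b c IHc a [eq_ab eq_c]; rewrite eq_ab eqxx /=.
exact: IHc.
Qed.

Section Tree.
Variables (T : {set E}) (T_tree : spanning_tree D T).

(** A simple path in T - e from the head of e to its tail would close up with e to a cycle in T. *)
Lemma tree_not_same_shore e : e \in T ->
  ~~ same_shore D T e (head D e) (tail D e).
Proof.
move=> eT; apply/negP => /connectP[p0 path_p0 last_p0].
move: path_p0 last_p0 => /shortenP[p path_p uniq_p _] last_p.
have [c [cT c_src c_tgt uniq_c]] := uniq_path_darts path_p uniq_p.
have /negP[] := T_tree.2 ((e, true) :: c).
rewrite /graph_cycle /= eT uniq_c c_src /= {1}/dart_src /=.
have -> : all (fun a => a.1 \in T) c.
  by apply: sub_all cT => a; rewrite inE => /andP[].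
have -> : e \notin [seq a.1 | a <- c].
  apply/mapP => -[a ac e_a]; move/allP: cT => /(_ a ac).
  by rewrite -e_a !inE eqxx.
rewrite rcons_path (dart_path (a := (e, true))) ?c_src ?c_tgt //=.
rewrite /dart_src /= andbT -/(uniq (tail D e :: _)).
move: uniq_p; rewrite lastI -last_p rcons_uniq => uniq_p.
by rewrite -(last_map (dart_tgt D)) c_tgt /= -last_p eqxx.
Qed.

(** Follow a path of T from the head of e: every step stays in its shore, except that crossing e
    lands on an end of e. *)
Lemma tree_shores e v : e \in T ->
  same_shore D T e (head D e) v || same_shore D T e (tail D e) v.
Proof.
move=> eT; case/connectP: (T_tree.1 (head D e) v) => p.
elim/last_ind: p v => [|p w IHp] v /=.
  by move=> _ ->; rewrite /same_shore connect0.
rewrite rcons_path last_rcons => /andP[path_p /existsP[f /andP[fT f_pw]] -> {v}].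
have [<-|fe] := eqVneq f e.
  by case/orP: f_pw => /andP[/eqP-> /eqP->]; rewrite /same_shore connect0 ?orbT.
have sh : same_shore D T e (last (head D e) p) w.
  by case/orP: f_pw (same_shoreP fT fe) => /andP[/eqP-> /eqP->] //;
     rewrite same_shore_sym.
by case/orP: (IHp _ path_p erefl) => /same_shore_trans /(_ sh) ->; rewrite ?orbT.
Qed.

End Tree.

(** * Coordinates with respect to the edge vectors of a spanning tree *)

Section Coordinates.
Variable K : pzRingType.
Implicit Types x y : {ffun V -> K}.

(** This is [edge_vector] over an arbitrary ring, so that the expansions below apply to real points
    and to lattice points alike. *)
Definition incidence e : {ffun V -> K} :=
  [ffun v => (v == head D e)%:R - (v == tail D e)%:R].

(* The coordinate of x on the edge e, in the basis given by the edges of the tree T. *)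
Definition tree_coord T e x : K :=
  \sum_(v | same_shore D T e (head D e) v) x v.

Lemma tree_coord_comb T e (I : Type) (r : seq I) (P : pred I) (w : I -> K)
    (p : I -> {ffun V -> K}) x :
  (forall v, x v = \sum_(i <- r | P i) w i * p i v) ->
  tree_coord T e x = \sum_(i <- r | P i) w i * tree_coord T e (p i).
Proof.
move=> def_x; rewrite /tree_coord (eq_bigr _ (fun v _ => def_x v)) exchange_big.
by apply: eq_bigr => i _; rewrite mulr_sumr.
Qed.

Lemma sum_pred_incidence (P : pred V) e :
  \sum_(v | P v) incidence e v = (P (head D e))%:R - (P (tail D e))%:R.
Proof.
have sum_delta u : \sum_(v | P v) (v == u)%:R = (P u)%:R :> K.
  rewrite big_mkcond (bigD1 u) //= eqxx big1 ?addr0; first by case: (P u).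
  by move=> v /negbTE->; case: ifP.
by under eq_bigr do rewrite ffunE; rewrite sumrB !sum_delta.
Qed.

Lemma sum_incidence e : \sum_v incidence e v = 0.
Proof. by rewrite sum_pred_incidence subrr. Qed.

Lemma tree_coord_off_cut T e f : f \notin fund_cut D T e ->
  tree_coord T e (incidence f) = 0.
Proof.
rewrite inE negbK => sh; rewrite /tree_coord sum_pred_incidence.
suff -> : same_shore D T e (head D e) (head D f)
          = same_shore D T e (head D e) (tail D f) by rewrite subrr.
apply/idP/idP => /same_shore_trans; apply => //.
by rewrite same_shore_sym.
Qed.

Section Tree.
Variables (T : {set E}) (T_tree : spanning_tree D T).

(** Exactly one end of f lies in the shore of the head of e, and the sign tells whether it is the
    head or the tail of f. *)
Lemma tree_coord_cut e f : e \in T -> f \in fund_cut D T e ->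
  tree_coord T e (incidence f) = (-1) ^+ ~~ stands_parallel D T e f.
Proof.
move=> eT; rewrite inE /stands_parallel /tree_coord sum_pred_incidence => cut_f.
case: (boolP (same_shore _ _ _ _ (head D f))) => [hf|hf].
  suff /negbTE-> : ~~ same_shore D T e (head D e) (tail D f) by rewrite subr0.
  apply: contra cut_f; rewrite same_shore_sym => /same_shore_trans; exact.
have tf : same_shore D T e (head D e) (tail D f).
  apply: contraR cut_f => tf.
  have := tree_shores T_tree (tail D f) eT; rewrite (negbTE tf) /=.
  rewrite same_shore_sym => /same_shore_trans; apply.
  by have := tree_shores T_tree (head D f) eT; rewrite (negbTE hf).
by rewrite tf sub0r.
Qed.

Lemma tree_coord_edge e f : e \in T -> f \in T ->
  tree_coord T e (incidence f) = (f == e)%:R.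
Proof.
move=> eT fT; have [->|fe] := eqVneq f e; last first.
  by apply: tree_coord_off_cut; rewrite inE negbK same_shoreP.
rewrite tree_coord_cut //; first by rewrite /stands_parallel /same_shore connect0.
by rewrite inE same_shore_sym tree_not_same_shore.
Qed.

Definition tree_expanded x :=
  forall v, x v = \sum_(e in T) tree_coord T e x * incidence e v.

Lemma tree_expanded_comb (I : finType) (w : I -> K) (p : I -> {ffun V -> K}) x :
  (forall v, x v = \sum_i w i * p i v) ->
  (forall i, tree_expanded (p i)) -> tree_expanded x.
Proof.
move=> def_x exp_p v; rewrite def_x.
under [RHS]eq_bigr do rewrite (tree_coord_comb _ _ def_x) mulr_suml.
rewrite exchange_big; apply: eq_bigr => i _; rewrite exp_p mulr_sumr.
by apply: eq_bigr => e _; rewrite mulrA.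
Qed.

Lemma tree_expanded_incidence e : e \in T -> tree_expanded (incidence e).
Proof.
move=> eT v; rewrite (bigD1 e) //= tree_coord_edge // eqxx mul1r.
rewrite big1 ?addr0 // => f /andP[fT fe].
by rewrite tree_coord_edge // eq_sym (negbTE fe) mul0r.
Qed.

(** Telescoping along a path of the tree from r to u. *)
Lemma tree_expanded_diff r u :
  tree_expanded [ffun v => (v == u)%:R - (v == r)%:R].
Proof.
case/connectP: (T_tree.1 r u) => p.
elim/last_ind: p u => [|p w IHp] u /=.
  move=> _ ->; apply: (@tree_expanded_comb void (fun=> 0) (fun=> 0)) => [v|[]].
  by rewrite big_pred0 // ffunE subrr.
rewrite rcons_path last_rcons => /andP[path_p /existsP[f /andP[fT f_pw]] -> {u}].
pose y := [ffun v => (v == last r p)%:R - (v == r)%:R] : {ffun V -> K}.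
have exp_y : tree_expanded y by apply: IHp path_p erefl.
(* The sign [b] records whether the last edge [f] is traversed forwards or backwards. *)
have [b def_w] : exists b, forall v,
    ([ffun v => (v == w)%:R - (v == r)%:R] : {ffun V -> K}) v
    = 1 * y v + (-1) ^+ (b : bool) * incidence f v.
  by case/orP: f_pw => /andP[/eqP eq1 /eqP eq2]; [exists false | exists true] => v;
    rewrite !ffunE eq1 eq2 ?mulN1r ?mul1r ?opprB [RHS]addrC addrA subrK.
apply: (@tree_expanded_comb bool (fun b' => if b' then 1 else (-1) ^+ b)
          (fun b' => if b' then y else incidence f)) => [v|[]].
- by rewrite def_w big_bool.
- exact: exp_y.
- exact: tree_expanded_incidence.
Qed.

Lemma tree_expansion x : \sum_v x v = 0 -> tree_expanded x.
Proof.
(* The vertex at which the expansion is evaluated also supplies the base point [r]. As x has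
   coordinate sum 0, it is the combination of the differences of unit vectors at u and [r] with
   coefficients x(u). *)
move=> sum_x v; move: v (v) => r.
apply: (@tree_expanded_comb V x (fun u => [ffun v => (v == u)%:R - (v == r)%:R])).
  move=> v; under eq_bigr do rewrite ffunE mulrBr.
  rewrite sumrB -[X in _ - X]mulr_suml sum_x mul0r subr0.
  rewrite (bigD1 v) //= eqxx mulr1 big1 ?addr0 // => u uv.
  by rewrite eq_sym (negbTE uv) mulr0.
by move=> u; apply: tree_expanded_diff.
Qed.

Lemma tree_coord_sum (a : E -> K) x e : e \in T ->
  (forall v, x v = \sum_(f in T) a f * incidence f v) ->
  tree_coord T e x = a e.
Proof.
move=> eT /tree_coord_comb ->; rewrite (bigD1 e) //= tree_coord_edge // eqxx mulr1.
rewrite big1 ?addr0 // => f /andP[fT fe].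
by rewrite tree_coord_edge // (negbTE fe) mulr0.
Qed.

End Tree.
End Coordinates.
End Trees.

(** * Convex combinations, and properties valid for small positive parameters *)

Section Convexity.
Variables (R : realType) (V : finType).
Implicit Types (A : set {ffun V -> R}) (x y : {ffun V -> R}).

Lemma conv_hull_fin (I : finType) A (p : I -> {ffun V -> R}) (w : I -> R) x :
  (forall i, A (p i)) -> (forall i, 0 <= w i) -> \sum_i w i = 1 ->
  (forall v, x v = \sum_i w i * p i v) -> conv_hull A x.
Proof.
move=> Ap w0 w1 def_x.
exists #|I|, (fun j => p (enum_val j)), (fun j => w (enum_val j)); split=> //.
- by rewrite -w1 [RHS](big_enum_val (A := I)).
- by move=> v; rewrite def_x [LHS](big_enum_val (A := I)).
Qed.

Lemma conv_hull_segment A x y (t : R) : conv_hull A x -> conv_hull A y ->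
  0 <= t <= 1 -> conv_hull A [ffun v => (1 - t) * x v + t * y v].
Proof.
case=> n [p [w [Ap w0 w1 def_x]]] [m [q [u [Aq u0 u1 def_y]]]] /andP[t0 t1].
apply: (@conv_hull_fin ('I_n + 'I_m)%type _
   (fun s => match s with inl i => p i | inr j => q j end)
   (fun s => match s with inl i => (1 - t) * w i | inr j => t * u j end)).
- by case.
- by case=> i; rewrite mulr_ge0 // subr_ge0.
- by rewrite big_sumType /= -!mulr_sumr w1 u1 !mulr1 subrK.
- move=> v; rewrite ffunE def_x def_y !mulr_sumr big_sumType /=.
  by congr (_ + _); apply: eq_bigr => i _; rewrite mulrA.
Qed.

(** Validity on a right neighbourhood of 0, with 0 excluded. Stability under finite conjunctions
    lets one parameter serve all trees and edges. *)
Definition eventually0 (P : R -> Prop) : Prop :=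
  exists2 d : R, 0 < d & forall t, 0 < t < d -> P t.

Lemma eventually0_forall (I : finType) (P : I -> R -> Prop) :
  (forall i, eventually0 (P i)) -> eventually0 (fun t => forall i, P i t).
Proof.
move=> evP; suff [d d0 dP] : eventually0 (fun t => forall i, i \in enum I -> P i t).
  by exists d => // t td i; apply: dP; rewrite ?mem_enum.
elim: (enum I) => [|i s [d d0 IHs]]; first by exists 1.
have [d' d'0 iP] := evP i; exists (Num.min d d'); first by rewrite lt_min d0.
move=> t; rewrite lt_min => /and3P[t0 td td'] j; rewrite inE => /predU1P[->|js].
  by apply: iP; rewrite t0.
by apply: IHs; rewrite ?t0.
Qed.

Lemma eventually0_and (P Q : R -> Prop) :
  eventually0 P -> eventually0 Q -> eventually0 (fun t => P t /\ Q t).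
Proof.
case=> [d d0 dP] [d' d'0 d'Q]; exists (Num.min d d'); first by rewrite lt_min d0.
by move=> t; rewrite lt_min => /and3P[t0 td td']; split; [apply: dP | apply: d'Q]; rewrite t0.
Qed.

Lemma eventually0_ex (P : R -> Prop) : eventually0 P -> exists2 t, 0 < t < 1 & P t.
Proof.
case=> d d0 dP; exists (Num.min d 1 / 2).
  by case: (leP d 1) => ?; lra.
by apply: dP; case: (leP d 1) => ?; lra.
Qed.

Lemma eventually0_segment_gt0 (a b : R) : 0 < a \/ a = 0 /\ 0 < b ->
  eventually0 (fun t => 0 < (1 - t) * a + t * b).
Proof.
case=> [a0|[-> b0]]; last by exists 1 => // t t01; nra.
have ab0 : 0 < a + `|a - b| by apply: ltr_wpDr.
(* Below this bound t |a - b| < (1 - t) a, so the value a - t (a - b) stays positive; the extra a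
   keeps the denominator nonzero when a = b. *)
exists (a / (a + `|a - b|)); first by rewrite divr_gt0.
move=> t /andP[t0]; rewrite ltr_pdivlMr // => lt_t.
have := ler_norm (a - b); nra.
Qed.

Lemma eventually0_segment_lt0 (a b : R) : a < 0 \/ a = 0 /\ b < 0 ->
  eventually0 (fun t => (1 - t) * a + t * b < 0).
Proof.
move=> ab; have [|d d0 dP] := @eventually0_segment_gt0 (- a) (- b).
  by case: ab => [a0|[-> b0]]; [left | right]; rewrite ?oppr_gt0 ?oppr0.
by exists d => // t /dP; nra.
Qed.

End Convexity.

(** * Root polytopes, and the simplex of a spanning tree in coordinates *)

Section RootPolytopes.
Variables (R : realType) (V E : finType) (D : digraph V E).
Implicit Types (F T : {set E}) (x y : {ffun V -> R}).

Lemma big_option_type (G : option E -> R) :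
  \sum_o G o = G None + \sum_e G (Some e).
Proof.
rewrite (bigD1 None) //= (reindex_omap Some id) => [|[]] //=.
by congr (_ + _); apply: eq_bigl => e; rewrite eqxx.
Qed.

Lemma root_polytope_of_comb F (a : E -> R) x :
  (forall e, e \in F -> 0 <= a e) -> \sum_(e in F) a e <= 1 ->
  (forall v, x v = \sum_(e in F) a e * incidence D R e v) ->
  root_polytope_of D R F x.
Proof.
move=> a0 a1 def_x.
(* The index [None] puts the weight missing from 1 on the origin; edges outside F get weight 0. *)
apply: (@conv_hull_fin _ _ (option E) _
   (fun o => if o is Some e then if e \in F then edge_vector D R e else [ffun=> 0]
             else [ffun=> 0])
   (fun o => if o is Some e then if e \in F then a e else 0
             else 1 - \sum_(e in F) a e)).
- case=> [e|]; last by left.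
  by case: ifP => eF; [right; exists e | left].
- by case=> [e|]; [case: ifP => // /a0 | rewrite subr_ge0].
- by rewrite big_option_type -big_mkcond subrK.
- move=> v; rewrite big_option_type ffunE mulr0 add0r def_x big_mkcond.
  by apply: eq_bigr => e _; case: ifP; rewrite ?mul0r.
Qed.

Lemma root_polytope_of_sum0 F x : root_polytope_of D R F x -> \sum_v x v = 0.
Proof.
case=> n [p [w [Fp _ _ def_x]]].
rewrite (eq_bigr _ (fun v _ => def_x v)) exchange_big big1 //= => i _.
rewrite -mulr_sumr; case: (Fp i) => [->|[e _ <-]].
  by rewrite big1 ?mulr0 // => v _; rewrite ffunE.
by rewrite [X in _ * X](sum_incidence D R) mulr0.
Qed.

Lemma aff_hull_root_polytope_sum0 F x :
  aff_hull (root_polytope_of D R F) x -> \sum_v x v = 0.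
Proof.
case=> n [p [w [Fp _ def_x]]].
rewrite (eq_bigr _ (fun v _ => def_x v)) exchange_big big1 //= => i _.
by rewrite -mulr_sumr (root_polytope_of_sum0 (Fp i)) mulr0.
Qed.

Lemma root_polytope0 F : root_polytope_of D R F [ffun=> 0].
Proof.
apply: (@root_polytope_of_comb _ (fun=> 0)) => //; first by rewrite big1.
by move=> v; rewrite ffunE big1 // => e _; rewrite mul0r.
Qed.

Section Tree.
Variables (T : {set E}) (T_tree : spanning_tree D T).

(** The tree coordinates, with 1 minus their sum at the origin, are the barycentric coordinates of
    the simplex. Being linear, the inequalities need only be checked at the vertices. *)
Lemma tree_polytopeP x : root_polytope_of D R T x <->
  [/\ \sum_v x v = 0, forall e, e \in T -> 0 <= tree_coord D T e x &
      \sum_(e in T) tree_coord D T e x <= 1].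
Proof.
split=> [Tx|[x0 c0 c1]]; last first.
  exact: (root_polytope_of_comb c0 c1 (tree_expansion T_tree x0)).
have x0 := root_polytope_of_sum0 Tx; case: Tx => n [p [w [Tp w0 w1 def_x]]].
have p_ge0 e i : e \in T -> 0 <= tree_coord D T e (p i).
  move=> eT; case: (Tp i) => [->|[f fT <-]].
    by rewrite /tree_coord big1 // => v _; rewrite ffunE.
  by rewrite (tree_coord_edge R T_tree eT fT) ler0n.
split=> // [e eT|].
  by rewrite (tree_coord_comb _ _ _ def_x) sumr_ge0 // => i _; rewrite mulr_ge0 ?p_ge0.
under eq_bigr do rewrite (tree_coord_comb _ _ _ def_x).
rewrite exchange_big -w1; apply: ler_sum => i _; rewrite -mulr_sumr ler_piMr //.
case: (Tp i) => [->|[f fT <-]].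
  by rewrite big1 // => e _; rewrite /tree_coord big1 // => v _; rewrite ffunE.
rewrite (eq_bigr (fun e => (f == e)%:R)) => [|e eT]; last first.
  exact: (tree_coord_edge R T_tree eT fT).
rewrite (bigD1 f) //= eqxx big1 ?addr0 // => e /andP[_].
by rewrite eq_sym => /negbTE->.
Qed.

Lemma tree_coord_dist x y e (eps : R) : (forall v, `|y v - x v| < eps) ->
  `|tree_coord D T e y - tree_coord D T e x| <= #|V|%:R * eps.
Proof.
move=> xy; rewrite /tree_coord -sumrB (le_trans (ler_norm_sum _ _ _)) //.
rewrite mulr_natl -sumr_const [leRHS](bigID (same_shore D T e (head D e))) /=.
rewrite ler_wpDr ?ler_sum // => [|v _]; last exact: ltW.
by rewrite sumr_ge0 // => v _; apply: le_trans (ltW (xy v)).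
Qed.

Lemma tree_polytope_interior x : \sum_v x v = 0 ->
  (forall e, e \in T -> 0 < tree_coord D T e x) ->
  \sum_(e in T) tree_coord D T e x < 1 ->
  rel_interior (root_polytope_of D R T) x.
Proof.
move=> x0 c0 c1; split.
  by apply/tree_polytopeP; split=> // [e /c0 /ltW|]; last exact: ltW.
(* The radius [t] is so small that all strict inequalities survive when every coordinate moves by at
   most |V| t. *)
suff [t /andP[t0 _] [tP1 tP2]] : exists2 t : R, 0 < t < 1 &
    (forall e, e \in T -> #|V|%:R * t < tree_coord D T e x) /\
    \sum_(e in T) (#|V|%:R * t) < 1 - \sum_(e in T) tree_coord D T e x.
  exists t => // y /aff_hull_root_polytope_sum0 y0 xy; apply/tree_polytopeP.
  have cxy e := tree_coord_dist e xy; split=> // [e eT|].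
    by have := cxy e; have := tP1 e eT; rewrite ler_norml; lra.
  have : \sum_(e in T) tree_coord D T e y
      <= \sum_(e in T) (tree_coord D T e x + #|V|%:R * t).
    by apply: ler_sum => e _; have := cxy e; rewrite ler_norml; lra.
  by rewrite big_split /=; lra.
(* The successor in the denominator covers the case c = 0. *)
have ev c b : 0 < b -> eventually0 (fun t : R => c%:R * t < b).
  move=> b0; exists (b / c.+1%:R); first by rewrite divr_gt0.
  move=> t /andP[t0]; rewrite ltr_pdivlMr //; apply: le_lt_trans.
  by rewrite mulrC ler_wpM2l ?ler_nat // ltW.
have ev1 : eventually0 (fun t : R =>
    forall e, e \in T -> #|V|%:R * t < tree_coord D T e x).
  apply: eventually0_forall => e; case: (boolP (e \in T)) => [eT|_].
    by have [d d0 dP] := ev #|V| _ (c0 e eT); exists d => // t /dP.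
  by exists 1.
suff ev2 : eventually0 (fun t : R =>
    \sum_(e in T) (#|V|%:R * t) < 1 - \sum_(e in T) tree_coord D T e x).
  exact: eventually0_ex (eventually0_and ev1 ev2).
have [|d d0 dP] := ev (#|V| * #|T|)%N (1 - \sum_(e in T) tree_coord D T e x).
  by rewrite subr_gt0.
exists d => // t /dP; apply: le_lt_trans.
by rewrite sumr_const -[leLHS]mulr_natr natrM mulrAC.
Qed.

End Tree.

End RootPolytopes.

(** * The generic point and the half-open simplices it determines *)

Section HalfOpen.
Variables (R : realType) (V E : finType) (D : digraph V E) (le : rel E).
Hypotheses (leE_anti : antisymmetric le) (leE_trans : transitive le).
Hypothesis leE_total : total le.

(** Its cardinality serves as a numerical rank that strictly decreases along the ordering. *)
Definition above f : {set E} := [set g | le f g && (g != f)].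

Lemma card_above_lt f g : le f g -> f != g -> (#|above g| < #|above f|)%N.
Proof.
move=> le_fg fg; apply: proper_card; apply/properP; split.
  apply/fintype.subsetP => h; rewrite !inE => /andP[le_gh hg].
  rewrite (leE_trans le_fg le_gh); apply: contraNneq fg => eq_hf.
  by apply/eqP/leE_anti; rewrite le_fg -eq_hf.
by exists g; rewrite inE ?eqxx ?andbF // le_fg eq_sym.
Qed.

Lemma exists_min (C : {set E}) e : e \in C ->
  exists2 f, f \in C & forall g, g \in C -> le f g.
Proof.
move=> eC; case: (arg_maxnP (fun f => #|above f|) eC) => f fC max_f.
exists f => // g gC; case/orP: (leE_total f g) => //.
have [<-//|gf le_gf] := eqVneq g f.
by have := leq_trans (card_above_lt le_gf gf) (max_f g gC); rewrite ltnn.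
Qed.

(** Take powers of B = |E| + 1 with the rank as exponent: later edges lose a factor B each, and
    there are fewer than B of them. Dividing by B (1 + S), where S is the sum of these powers, makes
    the last quantity S / (1 + S). *)
Lemma exists_dominating_weights : exists w : E -> R,
  [/\ forall f, 0 < w f, forall f, \sum_(g in above f) w g < w f
    & #|E|.+1%:R * \sum_f w f < 1].
Proof.
set B : R := #|E|.+1%:R.
have B0 : 0 < B by rewrite ltr0n.
have B1 : 1 <= B by rewrite ler1n.
pose S := \sum_f B ^+ #|above f|.
have S0 : 0 <= S by apply: sumr_ge0 => f _; rewrite exprn_ge0 // ltW.
have c0 : 0 < (B * (1 + S))^-1 by rewrite invr_gt0 mulr_gt0 // ltr_wpDr.
exists (fun f => (B * (1 + S))^-1 * B ^+ #|above f|); split=> [f|f|].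
- by rewrite mulr_gt0 // exprn_gt0.
- rewrite -mulr_sumr ltr_pM2l //.
  have le_B : (\sum_(g in above f) B ^+ #|above g|) * B
              <= \sum_(g in above f) B ^+ #|above f|.
    rewrite mulr_suml; apply: ler_sum => g; rewrite inE => /andP[le_fg gf].
    by rewrite -exprSr ler_weXn2l // card_above_lt // eq_sym.
  rewrite -(ltr_pM2r B0); apply: le_lt_trans le_B _.
  by rewrite sumr_const -mulr_natr ltr_pM2l ?exprn_gt0 // ltr_nat ltnS max_card.
- rewrite -mulr_sumr -/S mulrA invfM mulrA mulfV ?gt_eqF // mul1r mulrC.
  by rewrite ltr_pdivrMr ?ltr_wpDr // mul1r ltrDr.
Qed.

Section GenericPoint.
Variables (w : E -> R) (q : {ffun V -> R}).
Hypotheses (w_gt0 : forall f, 0 < w f).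
Hypothesis (w_dom : forall f, \sum_(g in above f) w g < w f).
Hypothesis (w_small : #|E|.+1%:R * \sum_f w f < 1).
Hypothesis (q_def : forall v, q v = \sum_f w f * incidence D R f v).

Lemma generic_point_sum0 : \sum_v q v = 0.
Proof.
rewrite (eq_bigr _ (fun v _ => q_def v)) exchange_big big1 //= => f _.
by rewrite -mulr_sumr sum_incidence mulr0.
Qed.

Lemma sum_weights_lt1 : \sum_f w f < 1.
Proof.
apply: le_lt_trans w_small; rewrite ler_peMl ?ler1n //.
by apply: sumr_ge0 => f _; apply: ltW.
Qed.

Lemma generic_point_in : ext_root_polytope D R q.
Proof.
apply: (@root_polytope_of_comb _ _ _ _ _ w) => [e _||v]; first exact: ltW.
  by under eq_bigl do rewrite inE; apply/ltW/sum_weights_lt1.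
by rewrite q_def; apply: eq_bigl => e; rewrite inE.
Qed.

Variables (T : {set E}) (T_tree : spanning_tree D T).

Lemma norm_tree_coord_incidence e f : e \in T ->
  `|tree_coord D T e (incidence D R f)| <= (f \in fund_cut D T e)%:R.
Proof.
move=> eT; case: (boolP (f \in _)) => fC.
  by rewrite (tree_coord_cut R T_tree) // normr_sign.
by rewrite tree_coord_off_cut // normr0.
Qed.

Lemma generic_tree_coord_le e : e \in T -> tree_coord D T e q <= \sum_f w f.
Proof.
move=> eT; rewrite (tree_coord_comb _ _ _ q_def); apply: ler_sum => f _.
rewrite ler_piMr ?(ltW (w_gt0 f)) //; apply: (le_trans (ler_norm _)).
by apply: (le_trans (norm_tree_coord_incidence _ eT)); rewrite lern1 leq_b1.
Qed.

(** At most |E| coordinates, each at most the total weight. Hence the facet opposite to the origin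
    is never visible from q, and no half-open simplex loses it. *)
Lemma generic_sum_tree_coord_lt1 : \sum_(e in T) tree_coord D T e q < 1.
Proof.
apply: le_lt_trans w_small.
apply: le_trans (ler_sum _ generic_tree_coord_le) _.
rewrite sumr_const -[leLHS]mulr_natl ler_wpM2r ?ler_nat ?sumr_ge0 //.
  by move=> f _; apply: ltW.
by rewrite leqW // max_card.
Qed.

(* The weights decrease so fast that the minimal edge of the cut decides the sign. *)
Lemma generic_tree_coord_near e f : e \in T -> f \in fund_cut D T e ->
  (forall g, g \in fund_cut D T e -> le f g) ->
  `|tree_coord D T e q - w f * tree_coord D T e (incidence D R f)| < w f.
Proof.
move=> eT fC min_f; rewrite (tree_coord_comb _ _ _ q_def) (bigD1 f) //= addrAC subrr add0r.
apply: le_lt_trans (w_dom f); apply: le_trans (ler_norm_sum _ _ _) _.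
rewrite [leRHS]big_mkcond [leLHS]big_mkcond /=; apply: ler_sum => g _.
have [_|gf] := eqVneq g f; first by case: ifP => // _; apply: ltW.
rewrite inE gf andbT normrM (gtr0_norm (w_gt0 g)) /=.
have := norm_tree_coord_incidence g eT.
case: (boolP (g \in _)) => [/min_f-> | _] /= le1.
  by rewrite ler_piMr // ltW.
move: le1; rewrite normr_le0 => /eqP->; rewrite normr0 mulr0.
by case: ifP => // _; apply: ltW.
Qed.

Lemma generic_tree_coord_sign e : e \in T ->
  if semi_active D le T e then 0 < tree_coord D T e q
  else tree_coord D T e q < 0.
Proof.
move=> eT; case: ifP => [/existsP[f /and3P[fC /forallP min_f par_f]]|passive_e].
  have /= := generic_tree_coord_near eT fC (fun g => implyP (min_f g)).
  by rewrite (tree_coord_cut R T_tree) // par_f mulr1 ltr_norml; lra.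
(* The cut contains e, so it has a minimal edge; if that edge stood parallel, e would be
   semi-active. *)
have eC : e \in fund_cut D T e.
  by rewrite inE same_shore_sym tree_not_same_shore.
have [f fC min_f] := exists_min eC.
have := generic_tree_coord_near eT fC min_f.
rewrite (tree_coord_cut R T_tree) //; case: (boolP (stands_parallel _ _ _ _)) => par_f.
  case/existsP: passive_e; exists f; rewrite fC par_f andbT.
  by apply/forallP => g; apply/implyP/min_f.
by rewrite mulrN1 ltr_norml; lra.
Qed.

End GenericPoint.

(** The ring varies because the dissection argument concerns real points and the count concerns
    integer points. *)
Definition half_open (K : numDomainType) (T : {set E}) (k : K) (x : {ffun V -> K}) : Prop :=
  [/\ \sum_v x v = 0, forall e, e \in T -> 0 <= tree_coord D T e x,
      forall e, e \in semi_passive_edges D le T -> 0 < tree_coord D T e x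
    & \sum_(e in T) tree_coord D T e x <= k].

Lemma tree_coord_segment T e (t : R) (x y : {ffun V -> R}) :
  tree_coord D T e [ffun v => (1 - t) * x v + t * y v]
  = (1 - t) * tree_coord D T e x + t * tree_coord D T e y.
Proof.
rewrite /tree_coord !mulr_sumr -big_split.
by apply: eq_bigr => v _; rewrite ffunE.
Qed.

Lemma sum_tree_coord_segment (T : {set E}) (t : R) (x y : {ffun V -> R}) :
  1 - \sum_(e in T) tree_coord D T e [ffun v => (1 - t) * x v + t * y v]
  = (1 - t) * (1 - \sum_(e in T) tree_coord D T e x)
    + t * (1 - \sum_(e in T) tree_coord D T e y).
Proof.
under eq_bigr do rewrite tree_coord_segment.
by rewrite big_split -!mulr_sumr /=; ring.
Qed.

(** * The half-open simplices partition the root polytope *)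

Section Dissection.
Variables (TT : {set {set E}}) (TT_diss : dissecting_tree_set D R TT).

(* Moving x slightly towards the generic point q brings it into the interior of the
   simplex of T if x lies in the half-open simplex, and out of the simplex otherwise. *)
Lemma half_open_exists x : ext_root_polytope D R x ->
  exists2 T, T \in TT & half_open T 1 x.
Proof.
case: TT_diss => trees _ cover Dx.
have [w [w0 w_dom w_small]] := exists_dominating_weights.
pose q : {ffun V -> R} := [ffun v => \sum_f w f * incidence D R f v].
have q_def v : q v = \sum_f w f * incidence D R f v by rewrite ffunE.
pose seg t : {ffun V -> R} := [ffun v => (1 - t) * x v + t * q v].
(* By contraposition: where x violates a half-open inequality, [seg t] violates the closed one for
   small t. At a zero coordinate of a semi-passive edge this holds because q is negative there. *)
have ev1 : eventually0 (fun t => forall Te : {set E} * E,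
    Te.1 \in TT -> Te.2 \in Te.1 -> 0 <= tree_coord D Te.1 Te.2 (seg t) ->
    0 <= tree_coord D Te.1 Te.2 x /\
    (~~ semi_active D le Te.1 Te.2 -> 0 < tree_coord D Te.1 Te.2 x)).
  apply: eventually0_forall => -[T e] /=; case: (boolP (T \in TT)) => [/trees T_tree|_];
    last by exists 1.
  case: (boolP (e \in T)) => [eT|_]; last by exists 1.
  have sgn := generic_tree_coord_sign w0 w_dom q_def T_tree eT.
  have [c_lt0|c_gt0|c0] := ltgtP (tree_coord D T e x) 0.
  - have [d d0 dP] := eventually0_segment_lt0 (b := tree_coord D T e q) (or_introl c_lt0).
    by exists d => // t /dP; rewrite tree_coord_segment => lt0 _ _; rewrite leNgt lt0.
  - by exists 1.
  case: ifP sgn => [_ _|_ q_lt0]; first by exists 1.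
  have [d d0 dP] := eventually0_segment_lt0 (or_intror (conj c0 q_lt0)).
  by exists d => // t /dP; rewrite tree_coord_segment => lt0 _ _; rewrite leNgt lt0.
have ev2 : eventually0 (fun t => forall T : {set E}, T \in TT ->
    \sum_(e in T) tree_coord D T e (seg t) <= 1 ->
    \sum_(e in T) tree_coord D T e x <= 1).
  apply: eventually0_forall => T; case: (boolP (T \in TT)) => [/trees T_tree|_];
    last by exists 1.
  have [?|] := leP (\sum_(e in T) tree_coord D T e x) 1; first by exists 1.
  rewrite -subr_lt0 => c_lt0.
  have [d d0 dP] := eventually0_segment_lt0
    (b := 1 - \sum_(e in T) tree_coord D T e q) (or_introl c_lt0).
  exists d => // t /dP; rewrite -sum_tree_coord_segment => lt0 _.
  by rewrite -subr_ge0 leNgt lt0.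
(* The parameter is fixed for all trees at once, before the simplex containing [seg t] is known. *)
have [t /andP[t0 t1] [tP1 tP2]] := eventually0_ex (eventually0_and ev1 ev2).
have : ext_root_polytope D R (seg t).
  apply: conv_hull_segment => //; first exact: generic_point_in w_small q_def.
  by rewrite !ltW.
rewrite -cover => -[T /= T_TT /(tree_polytopeP (trees T T_TT)) [_ c0 c1]].
exists T => //; split.
- exact: root_polytope_of_sum0 Dx.
- by move=> e eT; case: (tP1 (T, e) T_TT eT (c0 e eT)).
- move=> e; rewrite inE => /andP[eT act_e].
  by case: (tP1 (T, e) T_TT eT (c0 e eT)) => _; apply.
- exact: tP2.
Qed.

(** Otherwise a point slightly closer to q would be interior to two distinct simplices of the
    dissection. *)
Lemma half_open_unique (x : {ffun V -> R}) T1 T2 : T1 \in TT -> T2 \in TT ->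
  half_open T1 1 x -> half_open T2 1 x -> T1 = T2.
Proof.
case: TT_diss => trees disj _ T1_TT T2_TT ho1 ho2.
have [//|neqT] := eqVneq T1 T2.
have [w [w0 w_dom w_small]] := exists_dominating_weights.
pose q : {ffun V -> R} := [ffun v => \sum_f w f * incidence D R f v].
have q_def v : q v = \sum_f w f * incidence D R f v by rewrite ffunE.
pose seg t : {ffun V -> R} := [ffun v => (1 - t) * x v + t * q v].
have ev T : T \in TT -> half_open T 1 x ->
    eventually0 (fun t => rel_interior (root_polytope_of D R T) (seg t)).
  move=> /trees T_tree [x0 c0 c_passive c1].
  have ev1 : eventually0 (fun t => forall e, e \in T -> 0 < tree_coord D T e (seg t)).
    apply: eventually0_forall => e; case: (boolP (e \in T)) => [eT|_]; last by exists 1.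
    have sgn := generic_tree_coord_sign w0 w_dom q_def T_tree eT.
    suff /eventually0_segment_gt0[d d0 dP] : 0 < tree_coord D T e x \/
        tree_coord D T e x = 0 /\ 0 < tree_coord D T e q.
      by exists d => // t /dP; rewrite -tree_coord_segment.
    have := c0 e eT; rewrite le_eqVlt => /predU1P[c_eq0|]; last by left.
    case: ifP sgn => [_ q_gt0|act_e _]; first by right; rewrite -c_eq0.
    by have := c_passive e; rewrite inE eT act_e; left; auto.
  have ev2 : eventually0 (fun t => 0 < 1 - \sum_(e in T) tree_coord D T e (seg t)).
    suff /eventually0_segment_gt0[d d0 dP] :
        0 < 1 - \sum_(e in T) tree_coord D T e x \/
        1 - \sum_(e in T) tree_coord D T e x = 0 /\
        0 < 1 - \sum_(e in T) tree_coord D T e q.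
      by exists d => // t /dP; rewrite -sum_tree_coord_segment.
    have q_lt1 := generic_sum_tree_coord_lt1 w0 w_small q_def T_tree.
    move: c1; rewrite -subr_ge0 le_eqVlt => /predU1P[eq0|]; last by left.
    by right; rewrite -eq0 subr_gt0.
  have [d d0 dP] := eventually0_and ev1 ev2; exists d => // t /dP[seg0 seg1].
  apply: tree_polytope_interior => //; last by rewrite -subr_gt0.
  under eq_bigr do rewrite ffunE.
  by rewrite big_split /= -!mulr_sumr x0 (generic_point_sum0 q_def) !mulr0 addr0.
have [t _ tP] := eventually0_ex (eventually0_and (ev T1 T1_TT ho1) (ev T2 T2_TT ho2)).
by have := disj T1 T2 T1_TT T2_TT neqT; rewrite -subset0 => /(_ (seg t) tP).
Qed.

End Dissection.
End HalfOpen.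

(** * The dimension of the root polytope *)

Section Dimension.
Variable R : realType.

Lemma conv_hull_sub (V : finType) (A : set {ffun V -> R}) x : A x -> conv_hull A x.
Proof.
move=> Ax; apply: (@conv_hull_fin _ _ unit _ (fun=> x) (fun=> 1)) => //.
  by rewrite sumr_const card_unit.
by move=> v; rewrite sumr_const card_unit mul1r.
Qed.

Lemma aff_indep_comp (V : finType) m n (p : 'I_n -> {ffun V -> R}) (f : 'I_m -> 'I_n) :
  injective f -> aff_indep p -> aff_indep (p \o f).
Proof.
move=> f_inj ind_p c c0 cp0 i.
pose c' j := \sum_(i | f i == j) c i.
have c'E (g : 'I_n -> R) : \sum_j c' j * g j = \sum_i c i * g (f i).
  rewrite [RHS](partition_big f xpredT) //=; apply: eq_bigr => j _.
  by rewrite mulr_suml; apply: eq_bigr => ? /eqP->.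
rewrite -[c i](_ : c' (f i) = c i).
  apply: ind_p => [|v]; last by rewrite c'E; apply: cp0.
  rewrite -[RHS]c0; have := c'E (fun=> 1).
  by under eq_bigr do rewrite mulr1; under [RHS]eq_bigr do rewrite mulr1.
rewrite /c' (big_pred1 i) // => j; exact: inj_eq.
Qed.

(** Subfamilies of affinely independent families are independent. This gives both the uniqueness of
    the h*-polynomial and the equal size of the trees. *)
Lemma has_dim_unique (V : finType) (A : set {ffun V -> R}) d d' :
  has_dim A d -> has_dim A d' -> d = d'.
Proof.
have lt_dim a b : (a < b)%N -> has_dim A a -> has_dim A b -> False.
  move=> lt_ab [_ no_p] [[p Ap ind_p] _].
  have le_ab : (a.+2 <= b.+1)%N by [].
  apply: (no_p (p \o widen_ord le_ab)) => [i|]; first exact: Ap.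
  by apply: aff_indep_comp ind_p => i j /(congr1 val) /= /val_inj.
by move=> dim_d dim_d'; case: (ltngtP d d') => // /lt_dim; case; auto.
Qed.

Variables (V E : finType) (D : digraph V E) (T : {set E}).
Hypothesis T_tree : spanning_tree D T.

Lemma has_dim_root_polytope : has_dim (ext_root_polytope D R) #|T|.
Proof.
split.
  (* Index 0 is the origin; the other points are the edge vectors of T, whose coordinates are
     Kronecker deltas. *)
  exists (fun i => if unlift ord0 i is Some j
                   then incidence D R (enum_val (A := mem T) j) else [ffun=> 0]).
    move=> i; case: unliftP => [j _|_]; last exact: root_polytope0.
    by apply: conv_hull_sub; right; exists (enum_val j); rewrite //= inE.
  move=> c c0 cp0.
  have cp v : ([ffun=> 0] : {ffun V -> R}) v
      = \sum_(j < #|T|) c (lift ord0 j) * incidence D R (enum_val j) v.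
    rewrite ffunE -[LHS](cp0 v) big_ord_recl unlift_none /=.
    rewrite [X in _ * X + _]ffunE mulr0 add0r.
    by apply: eq_bigr => j _; rewrite liftK.
  have c_lift j : c (lift ord0 j) = 0.
    have := tree_coord_comb D T (enum_val j) cp.
    rewrite (bigD1 j) //= (tree_coord_edge R T_tree) ?enum_valP // eqxx mulr1.
    rewrite big1 => [|i ij]; last first.
      by rewrite (tree_coord_edge R T_tree) ?enum_valP // (inj_eq enum_val_inj)
        (negbTE ij) mulr0.
    by rewrite addr0 => <-; rewrite /tree_coord big1 // => v _; rewrite ffunE.
  move=> i; case: (unliftP ord0 i) => [j ->//|->].
  by move: c0; rewrite big_ord_recl big1 ?addr0.
move=> p Dp ind_p.
(* Row i consists of 1 and the coordinates of [p i]. There are more rows than columns, and a nonzero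
   left kernel vector is an affine dependence. *)
pose M := \matrix_(i < #|T|.+2, j < #|T|.+1)
  (if unlift ord0 j is Some j' then tree_coord D T (enum_val (A := mem T) j') (p i)
   else 1).
have /rowV0Pn[u /sub_kermxP uM u0] : kermx M != 0.
  by rewrite kermx_eq0 -row_leq_rank -ltnNge ltnS rank_leq_col.
case/negP: u0; apply/eqP/rowP => i; rewrite mxE.
have uM0 j : \sum_i u 0 i * M i j = 0 by move/rowP: uM => /(_ j); rewrite !mxE.
apply: (ind_p (u 0)) => [|v].
  rewrite -[RHS](uM0 ord0); apply: eq_bigr => k _.
  by rewrite mxE unlift_none mulr1.
have exp_p k := tree_expansion T_tree (root_polytope_of_sum0 (Dp k)) v.
under eq_bigr do rewrite exp_p mulr_sumr.
rewrite exchange_big big1 //= => e eT.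
under eq_bigr do rewrite mulrA; rewrite -mulr_suml.
have := uM0 (lift ord0 (enum_rank_in eT e)).
under eq_bigr do rewrite mxE liftK enum_rankK_in //.
by move=> ->; rewrite mul0r.
Qed.

End Dimension.

(** * Lattice points of the dilates *)

Section Counting.
Variables (R : realType) (V E : finType) (D : digraph V E) (le : rel E).
Implicit Types (T : {set E}) (k : nat).

Lemma tree_coord_scale T e (a : R) (x : {ffun V -> R}) :
  tree_coord D T e [ffun v => a * x v] = a * tree_coord D T e x.
Proof. by rewrite /tree_coord mulr_sumr; apply: eq_bigr => v _; rewrite ffunE. Qed.

Lemma half_open_scale T (a c : R) (x : {ffun V -> R}) : 0 < a ->
  half_open D le T c x -> half_open D le T (a * c) [ffun v => a * x v].
Proof.
move=> a0 [x0 c0 cp c1]; split=> [|e eT|e ep|].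
- by under eq_bigr do rewrite ffunE; rewrite -mulr_sumr x0 mulr0.
- by rewrite tree_coord_scale mulr_ge0 ?c0 // ltW.
- by rewrite tree_coord_scale mulr_gt0 ?cp.
- by under eq_bigr do rewrite tree_coord_scale; rewrite -mulr_sumr ler_wpM2l // ltW.
Qed.

Lemma tree_coord0 T e : tree_coord D T e [ffun=> 0] = 0 :> R.
Proof. by rewrite /tree_coord big1 // => v _; rewrite ffunE. Qed.

(** Handles the dilation factor 0, where scaling back by 1/k is impossible: the origin has
    coordinate sum 0, within either bound. *)
Lemma half_open00 T : half_open D le T (0 : R) [ffun=> 0] <-> half_open D le T (1 : R) [ffun=> 0].
Proof.
have sum0 : \sum_(e in T) tree_coord D T e [ffun=> 0] = 0 :> R.
  by rewrite big1 // => e _; rewrite tree_coord0.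
by split=> -[x0 c0 cp c1]; split; rewrite // sum0.
Qed.

Lemma half_open0 T (x : {ffun V -> R}) : spanning_tree D T ->
  half_open D le T 0 x -> x = [ffun=> 0].
Proof.
move=> T_tree [x0 c0 _ c1].
have sum0 : \sum_(e in T) tree_coord D T e x == 0 by rewrite eq_le c1 sumr_ge0.
apply/ffunP => v; rewrite (tree_expansion T_tree x0) ffunE big1 // => e eT.
by move: sum0; rewrite psumr_eq0 // => /allP/(_ e); rewrite mem_index_enum eT
  => /(_ isT) /eqP ->; rewrite mul0r.
Qed.

Lemma half_open_intr T k (m : {ffun V -> int}) :
  half_open D le T (k%:R : R) [ffun v => (m v)%:~R] <-> half_open D le T k%:Z m.
Proof.
have sum_m : \sum_v ([ffun v => (m v)%:~R] : {ffun V -> R}) v = (\sum_v m v)%:~R.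
  by rewrite rmorph_sum; apply: eq_bigr => v _; rewrite ffunE.
have coord_m e : tree_coord D T e [ffun v => (m v)%:~R] = (tree_coord D T e m)%:~R :> R.
  by rewrite /tree_coord rmorph_sum; apply: eq_bigr => v _; rewrite ffunE.
have sum_coord : \sum_(e in T) tree_coord D T e [ffun v => (m v)%:~R]
    = (\sum_(e in T) tree_coord D T e m)%:~R :> R.
  by rewrite rmorph_sum; apply: eq_bigr.
rewrite /half_open sum_m sum_coord -[k%:R]/((k%:Z)%:~R) ler_int.
split=> -[x0 c0 cp c1]; split=> // [|e /c0|e /cp];
  rewrite ?coord_m ?ler0z ?ltr0z //.
  by apply/eqP; move/eqP: x0; rewrite intr_eq0.
by rewrite x0.
Qed.

Section Encoding.
Variables (T : {set E}) (T_tree : spanning_tree D T).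
Local Notation passive := (semi_passive_edges D le T).

(** The list [s] holds the coordinates in the order of [enum T], lowered by one on semi-passive
    edges, where they must be at least 1; so its entries are arbitrary naturals. *)
Definition tree_point (s : seq nat) : {ffun V -> int} :=
  [ffun v => \sum_(e in T) (nth 0%N s (index e (enum T)) + (e \in passive))%N%:Z
                           * incidence D int e v].

Lemma tree_coord_tree_point s e : e \in T ->
  tree_coord D T e (tree_point s)
  = (nth 0%N s (index e (enum T)) + (e \in passive))%N%:Z.
Proof.
move=> eT; apply: (tree_coord_sum T_tree (a := fun e =>
  (nth 0%N s (index e (enum T)) + (e \in passive))%N%:Z)) => // v.
by rewrite ffunE.
Qed.

Lemma sum_nth_index s : size s = #|T| ->
  (\sum_(e in T) nth 0 s (index e (enum T)) = sumn s)%N.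
Proof.
move=> sz_s; rewrite -{2}(map_nth_index 0%N (enum_uniq (mem T)) (t := s)).
  by rewrite sumnE big_map big_enum.
by rewrite -cardE.
Qed.

Lemma sum_passive : (\sum_(e in T) (e \in passive) = #|passive|)%N.
Proof.
rewrite -sum1_card [RHS]big_mkcond [LHS]big_mkcond; apply: eq_bigr => e _.
by rewrite inE; case: (e \in T).
Qed.

Lemma tree_point_half_open s k : size s = #|T| -> (sumn s + #|passive| <= k)%N ->
  half_open D le T k%:Z (tree_point s).
Proof.
move=> sz_s le_k; split=> [|e eT|e ep|].
- under eq_bigr do rewrite ffunE; rewrite exchange_big big1 //= => e _.
  by rewrite -mulr_sumr sum_incidence mulr0.
- by rewrite tree_coord_tree_point.
- have eT : e \in T by move: ep; rewrite inE => /andP[].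
  by rewrite tree_coord_tree_point // ep addn1.
- rewrite (eq_bigr _ (tree_coord_tree_point s)) -(rmorph_sum Posz) /=.
  by rewrite big_split /= sum_nth_index // sum_passive.
Qed.

Lemma half_open_tree_point k (m : {ffun V -> int}) : half_open D le T k%:Z m ->
  exists2 s, m = tree_point s & size s = #|T| /\ (sumn s + #|passive| <= k)%N.
Proof.
case=> m0 c0 cp c1.
(* Tree coordinates of a lattice point are integers, being sums of its entries. The subtraction
   never truncates, as they are positive on semi-passive edges. *)
pose a e := (`|tree_coord D T e m| - (e \in passive))%N.
pose s := [seq a e | e <- enum T].
have sz_s : size s = #|T| by rewrite size_map -cardE.
have aE e : e \in T ->
    (nth 0%N s (index e (enum T)) + (e \in passive))%N%:Z = tree_coord D T e m.
  move=> eT; rewrite (nth_map e) ?index_mem ?mem_enum // nth_index ?mem_enum //.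
  rewrite subnK ?gez0_abs ?c0 //.
  by case: (boolP (e \in passive)) => // /cp; rewrite absz_gt0 => /gt_eqF->.
exists s; first apply/ffunP => v.
  rewrite ffunE (tree_expansion T_tree m0); apply: eq_bigr => e eT.
  by rewrite aE.
split=> //; rewrite -lez_nat; apply: le_trans c1.
rewrite -(eq_bigr _ aE) -(rmorph_sum Posz) /=.
by rewrite big_split /= sum_nth_index // sum_passive.
Qed.

Lemma tree_point_inj s s' : size s = #|T| -> size s' = #|T| ->
  tree_point s = tree_point s' -> s = s'.
Proof.
rewrite cardE => sz_s sz_s' eq_s.
rewrite -(map_nth_index 0%N (enum_uniq (mem T)) sz_s).
rewrite -[RHS](map_nth_index 0%N (enum_uniq (mem T)) sz_s').
apply/eq_in_map => e; rewrite mem_enum => eT; apply: (@addIn (e \in passive)).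
by apply/eqP; rewrite -eqz_nat -!tree_coord_tree_point // eq_s.
Qed.

End Encoding.

Hypotheses (leE_anti : antisymmetric le) (leE_trans : transitive le).
Hypothesis leE_total : total le.
Variables (TT : {set {set E}}) (TT_diss : dissecting_tree_set D R TT).

Let trees T : T \in TT -> spanning_tree D T.
Proof. by case: TT_diss => + _ _; apply. Qed.

Lemma dilate_half_open k (y : {ffun V -> R}) :
  dilate k (ext_root_polytope D R) y <->
  exists2 T, T \in TT & half_open D le T k%:R y.
Proof.
have [->|k_gt0] := posnP k.
  split=> [[x Dx <-]|[T T_TT /(half_open0 (trees T_TT)) ->]].
    have -> : [ffun v => 0%:R * x v] = [ffun=> 0].
      by apply/ffunP => v; rewrite !ffunE mul0r.
    have [T T_TT /half_open00 hoT] := half_open_exists leE_anti leE_trans leE_total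
      TT_diss (root_polytope0 R D [set: E]).
    by exists T.
  exists [ffun=> 0]; first exact: root_polytope0.
  by apply/ffunP => v; rewrite !ffunE mul0r.
have k0 : 0 < k%:R :> R by rewrite ltr0n.
split=> [[x Dx <-]|[T T_TT hoT]].
  have [T T_TT hoT] := half_open_exists leE_anti leE_trans leE_total TT_diss Dx.
  by exists T => //; have := half_open_scale k0 hoT; rewrite mulr1.
have ki0 : 0 < k%:R^-1 :> R by rewrite invr_gt0.
exists [ffun v => k%:R^-1 * y v]; last first.
  by apply/ffunP => v; rewrite !ffunE mulVKf ?gt_eqF.
have := half_open_scale ki0 hoT; rewrite mulVf ?gt_eqF // => -[x0 c0 _ c1].
case: TT_diss => _ _ <-; exists T => //; apply/(tree_polytopeP (trees T_TT)).
by split.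
Qed.

Lemma half_open_dilate_unique k (y : {ffun V -> R}) T1 T2 : T1 \in TT -> T2 \in TT ->
  half_open D le T1 k%:R y -> half_open D le T2 k%:R y -> T1 = T2.
Proof.
move=> T1_TT T2_TT; have [->|k_gt0] := posnP k => ho1 ho2.
  have y0 := half_open0 (trees T1_TT) ho1; rewrite y0 in ho1 ho2.
  by apply: (half_open_unique leE_anti leE_trans leE_total TT_diss (x := [ffun=> 0]));
    rewrite -?half_open00.
have k0 : 0 < k%:R^-1 :> R by rewrite invr_gt0 ltr0n.
have {}ho1 := half_open_scale k0 ho1; have {}ho2 := half_open_scale k0 ho2.
rewrite mulVf ?pnatr_eq0 -?lt0n // in ho1 ho2.
exact: (half_open_unique leE_anti leE_trans leE_total TT_diss) ho1 ho2.
Qed.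

Variable d : nat.
Hypothesis card_trees : forall T, T \in TT -> #|T| = d.

Lemma ehrhart_root_polytope k :
  ehrhart (ext_root_polytope D R) k
  = (\sum_(T in TT) shifted_bin #|semi_passive_edges D le T| d k)%N.
Proof.
(* Lattice points correspond to pairs of a tree and a tuple of lowered coordinates. *)
pose S := [set p : {set E} * d.-tuple 'I_k.+1 | (p.1 \in TT) &&
  (\sum_(i <- p.2) i + #|semi_passive_edges D le p.1| <= k)%N].
pose seqn (t : d.-tuple 'I_k.+1) := [seq nat_of_ord i | i <- t].
have sumn_seqn t : sumn (seqn t) = (\sum_(i <- t) i)%N by rewrite sumnE big_map.
have size_seqn t : size (seqn t) = d by rewrite size_map size_tuple.
pose point (p : {set E} * d.-tuple 'I_k.+1) := tree_point p.1 (seqn p.2).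
have S_half_open p : p \in S -> half_open D le p.1 k%:Z (point p).
  case: p => T t; rewrite inE /= => /andP[T_TT le_k].
  apply: (tree_point_half_open (trees T_TT)); last by rewrite sumn_seqn.
  by rewrite size_seqn card_trees.
have point_inj : {in S &, injective point}.
  move=> p p' pS p'S eq_p.
  have ho := S_half_open _ pS; have ho' := S_half_open _ p'S.
  move: pS p'S; rewrite !inE => /andP[pT _] /andP[p'T _].
  have eq_T : p.1 = p'.1.
    apply: (half_open_dilate_unique (k := k) (y := [ffun v => (point p v)%:~R])).
    - exact: pT.
    - exact: p'T.
    - exact/half_open_intr/ho.
    - by rewrite eq_p; exact/half_open_intr/ho'.
  case: p p' eq_T pT {p'T ho ho'} eq_p => T t [T' t'] /= <- T_TT eq_t.
  congr (_, _); apply/val_inj/(inj_map val_inj).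
  by apply: (tree_point_inj (trees T_TT) _ _ eq_t); rewrite ?size_seqn ?card_trees.
have -> : ehrhart (ext_root_polytope D R) k = #|S|.
  (* Exhibiting the lattice points as a finite set makes [fset_set] meaningful. *)
  rewrite /ehrhart; suff -> : lattice_points (dilate k (ext_root_polytope D R))
      = [set` [fset point p | p in S]%fset]%classic.
    by rewrite set_fsetK card_in_imfset //= -cardE.
  apply/seteqP; split=> [m|m /imfsetP[p /= pS ->]]; last first.
    apply/dilate_half_open; exists p.1; first by move: pS; rewrite inE => /andP[].
    by apply/half_open_intr/S_half_open.
  move/dilate_half_open => [T T_TT /half_open_intr].
  case/(half_open_tree_point (trees T_TT)) => s -> [sz_s sum_s].
  have sz_t : size [seq inord i : 'I_k.+1 | i <- s] == d.
    by rewrite size_map sz_s card_trees.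
  (* Each entry of [s] is at most its sum, hence at most k, so [inord] loses nothing. *)
  have seqnE : seqn (Tuple sz_t) = s.
    rewrite /seqn /= -map_comp -[RHS]map_id; apply/eq_in_map => j js.
    rewrite /= inordK // ltnS; apply: leq_trans sum_s; rewrite sumnE.
    by rewrite (big_rem j) //= -addnA leq_addr.
  apply/imfsetP; exists (T, Tuple sz_t); last by rewrite /point seqnE.
  have le_t : (\sum_(i <- Tuple sz_t) i + #|semi_passive_edges D le T| <= k)%N.
    by rewrite -sumn_seqn seqnE.
  by rewrite /= inE; apply/andP; split.
rewrite -sum1_card; under eq_bigl do rewrite inE.
rewrite -(pair_big_dep (mem TT) (fun (T : {set E}) (t : d.-tuple 'I_k.+1) =>
  (\sum_(i <- t) i + #|semi_passive_edges D le T| <= k)%N) (fun _ _ => 1%N)) /=.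
(* When the semi-passive edges outnumber k there is no tuple, in accordance with the value 0 of
   [shifted_bin]. *)
apply: eq_bigr => T _; rewrite sum1_card /shifted_bin; case: leqP => le_k.
  rewrite -(card_tuple_sum_le d (leq_subr #|semi_passive_edges D le T| k)).
  by apply: eq_card => t; rewrite inE unfold_in leq_subRL // addnC.
by apply: eq_card0 => t; rewrite unfold_in; apply/negbTE; rewrite -ltnNge ltn_addl.
Qed.

End Counting.

(** * The h*-polynomial *)

Section Hstar.
Variables (R : realType) (V : finType).
Implicit Types (Q : set {ffun V -> R}) (h : {poly int}).

Lemma is_hstar_unique Q h h' : is_hstar Q h -> is_hstar Q h' -> h = h'.
Proof.
case=> d dim_d [_ hE] [d' dim_d' [_ h'E]]; apply/polyP => i.
by rewrite hE h'E (has_dim_unique dim_d dim_d').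
Qed.

Lemma hstar_polyE Q h : is_hstar Q h -> hstar_poly Q = h.
Proof.
move=> Qh; apply: (is_hstar_unique _ Qh).
exact: (xgetPex 0 (ex_intro [set h | is_hstar Q h]%classic h Qh)).
Qed.

End Hstar.

Theorem theorem3p4 (R : realType) (V E : finType) (D : digraph V E)
    (D_connected : weakly_connected D)
    (TT : {set {set E}}) (TT_dissecting : dissecting_tree_set D R TT)
    (le : rel E) (le_refl : reflexive le) (le_anti : antisymmetric le)
    (le_trans : transitive le) (le_total : total le) (i : nat) :
  (hstar_poly (ext_root_polytope D R))`_i =
    #|[set T in TT | #|semi_passive_edges D le T| == i]|%:Z.
Proof.
(* The half-open simplex containing the origin supplies a tree, whose size is the dimension. *)
have [T0 T0_TT _] := half_open_exists le_anti le_trans le_total TT_dissecting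
  (root_polytope0 R D [set: E]).
have dim T : T \in TT -> has_dim (ext_root_polytope D R) #|T|.
  by case: TT_dissecting => trees _ _ /trees; apply: has_dim_root_polytope.
have card_trees T : T \in TT -> #|T| = #|T0|.
  by move=> T_TT; apply: has_dim_unique (dim T T_TT) (dim T0 T0_TT).
pose h : {poly int} := \sum_(T in TT) 'X^#|semi_passive_edges D le T|.
have coef_h j : h`_j = \sum_(T in TT) (j == #|semi_passive_edges D le T|)%:Z.
  by rewrite coef_sum; apply: eq_bigr => T _; rewrite coefXn natz.
rewrite (@hstar_polyE _ _ _ h).
  rewrite coef_h -(rmorph_sum Posz) /= -sum1_card; congr Posz.
  under [RHS]eq_bigl do rewrite inE; rewrite [RHS]big_mkcondr.
  by apply: eq_bigr => T _; rewrite eq_sym; case: eqP.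
exists #|T0|; first exact: dim.
split=> [|j].
  (* Semi-passive edges belong to the tree, which bounds the degree by the dimension. *)
  apply: leq_trans (size_sum _ _ _) _; apply/bigmax_leqP => T T_TT.
  rewrite size_polyXn ltnS -(card_trees T T_TT) subset_leq_card //.
  by apply/fintype.subsetP => e; rewrite inE => /andP[].
have eh := ehrhart_root_polytope le_anti le_trans le_total TT_dissecting card_trees.
(* With the sums exchanged, the Cauchy product of each tree collapses to its monomial. *)
under eq_bigr do rewrite eh (rmorph_sum Posz) mulr_sumr.
rewrite exchange_big coef_h; apply: eq_bigr => T _.
by rewrite cauchy_shifted_bin.
Qed.
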